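(* Let $b > 1$ be an odd integer and let $\mu_b$ be the Cantor measure with base $b$ on $\mathbb{R}$. Then $\mu_b$ does not admit a Fourier frame; that is, there is no countable set $\Lambda \subset \mathbb{R}$ for which there exist constants $0 < A \le B < \infty$ such that $$A\|f\|_{L^2(\mu_b)}^2 \le \sum_{\lambda\in\Lambda}\left|\int_{\mathbb{R}} f(x)e^{-2\pi i\lambda x}\,d\mu_b(x)\right|^2 \le B\|f\|_{L^2(\mu_b)}^2$$ for every $f\in L^2(\mu_b)$.
   Context: For an integer $b>1$, let $\Omega=\{0,1\}^{\mathbb{N}}$ with $\mathbb{N}=\{1,2,\dots\}$, let $\nu$ be the fair Bernoulli measure on $\Omega$ (the infinite product of the uniform probability measures on $\{0,1\}$), and define $\pi:\Omega\to\mathbb{R}$ by $\pi(\omega)=\sum_{j=1}^{\infty} 2\omega_j/b^j$. The Cantor measure with base $b$ is the push-forward $\mu_b=\pi_{\#}\nu$, a Borel probability measure on $\mathbb{R}$. Here $L^2(\mu_b)$ denotes the space of complex-valued square-integrable functions. *)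

(* Defs.v *)
From HB Require Import structures.
From mathcomp Require Import all_boot all_order all_algebra.
From mathcomp Require Import all_classical all_reals all_analysis measurable_realfun.
From mathcomp Require Import complex.
From mathcomp Require Import ring lra.
Import Order.TTheory GRing.Theory Num.Theory.
Import numFieldNormedType.Exports.
Import Normc.

Set Implicit Arguments.
Unset Strict Implicit.
Unset Printing Implicit Defensive.

Local Open Scope classical_set_scope.
Local Open Scope ring_scope.

(* Sequences are indexed from 0: the coordinate omega_j, j = 1, 2, ..., is
   w j.-1, with digits 0 and 1 encoded as false and true. *)
Definition cylinders : set (set (nat -> bool)) :=
  [set C | exists i B, C = [set w | B (w i)]].

Definition Omega := g_sigma_algebraType cylinders.

Definition box (n : nat) (B : nat -> set bool) : set Omega :=
  [set w | forall i, (i < n)%N -> B i (w i)].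

Section fair_bernoulli.
Variable R : realType.

(* The infinite product of the uniform probability on bool. *)
Definition is_fair_bernoulli (nu : probability Omega R) : Prop :=
  forall (n : nat) (B : nat -> set bool),
    nu (box n B) = (\prod_(i < n) bernoulli_prob 2^-1 (B i))%E.

Let mu : {measure set (measurableTypeR R) -> \bar R} := lebesgue_measure.

(* Existence: the law of the binary digits of a uniform point of [0, 1[. *)
Let shift (x : R) : R := if 2^-1 <= x then 2 * x - 1 else 2 * x.
Let digits (x : measurableTypeR R) : Omega := fun i => 2^-1 <= iter i shift x.

Let word (s : seq bool) : set R :=
  [set x | 0 <= x < 1 /\
     forall i, (i < size s)%N -> digits x i = nth false s i].

Lemma digitsS x i : digits x i.+1 = digits (shift x) i.
Proof. by rewrite /digits iterSr. Qed.

Lemma wordE s : exists a : R,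
  [/\ 0 <= a, a + 2^-1 ^+ size s <= 1 &
      word s = `[a, a + 2^-1 ^+ size s[%classic].
Proof.
elim: s => [|c s [a [a0 a1 IH]]].
  exists 0; split; rewrite ?expr0 ?add0r//.
  by apply/seteqP; split => x /=; rewrite in_itv/=; [case|split].
have l0 : 0 < (2^-1 : R) ^+ size s by rewrite exprn_gt0// invr_gt0.
have wS x : word (c :: s) x <->
    [/\ 0 <= x < 1, digits x 0 = c & word s (shift x)].
  split=> [[x01 H]|[x01 H0 [s01 H]]].
    split => //; first exact: (H 0%N).
    split; last by move=> i is_; rewrite -digitsS; exact: (H i.+1).
    by rewrite /shift; case: ifPn => ?; lra.
  by split => // -[|i] // is_; rewrite digitsS; exact: H.
exists (2^-1 * (a + c%:R)); rewrite /= exprS.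
set l := _ ^+ _ in l0 a1 IH *.
case: c wS => wS; rewrite ?mulr1n ?mulr0n; split; [lra|lra| |lra|lra|].
- apply/seteqP; split => x; rewrite /= in_itv/=.
    move=> /wS[x01 d]; rewrite IH/= in_itv/= /shift; move: d.
    by rewrite /digits/= => ->; lra.
  move=> xa; apply/wS; rewrite IH/= in_itv/= /shift /digits/=.
  have -> : 2^-1 <= x by lra.
  by split => //; lra.
- apply/seteqP; split => x; rewrite /= in_itv/=.
    move=> /wS[x01 d]; rewrite IH/= in_itv/= /shift; move: d.
    by rewrite /digits/= => ->; lra.
  move=> xa; apply/wS; rewrite IH/= in_itv/= /shift /digits/=.
  have -> : (2^-1 <= x) = false by apply/negP; lra.
  by split => //; lra.
Qed.

Lemma measurable_shift :
  measurable_fun [set: measurableTypeR R] (shift : _ -> measurableTypeR R).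
Proof.
apply: measurable_fun_ifT.
- exact: measurable_fun_ler.
- by apply: measurable_funB => //; exact: measurable_funM.
- exact: measurable_funM.
Qed.

Lemma measurable_digits : measurable_fun [set: measurableTypeR R] digits.
Proof.
have mO : @measurable _ Omega = <<s cylinders >> by [].
apply: (measurability _ mO).
move=> _ [_ [i [B ->]] <-]; rewrite setTI.
have m : measurable_fun setT (fun x => digits x i).
  apply: measurable_fun_ler => //.
  elim: i => [|i IH] /=; first exact: measurable_id.
  exact: (measurableT_comp measurable_shift IH).
by have := m measurableT B; rewrite setTI; exact.
Qed.

HB.instance Definition _ :=
  isMeasurableFun.Build _ _ _ _ digits measurable_digits.

Lemma measurable_box n B : measurable (box n B).
Proof.
have -> : box n B = \bigcap_(i in `I_n) [set w : Omega | B i (w i)].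
  by apply/seteqP; split => w H i; [exact: H|move=> ?; exact: H].
apply: bigcap_measurableType => i _.
by apply: sub_sigma_algebra; exists i, (B i).
Qed.

Let unif : probability (measurableTypeR R) R := uniform_prob (@ltr01 R).

Lemma unif_itv a b : 0 <= a <= b -> b <= 1 ->
  unif `[a, b[%classic = (b - a)%:E.
Proof.
move=> ab b1; rewrite /unif/= /uniform_prob.
rewrite (eq_integral (fun=> 1%E)); last first.
  move=> x; rewrite inE/= in_itv/= /uniform_pdf => xab.
  by rewrite (_ : _ <= _ <= _ = true) ?subr0 ?invr1//; lra.
rewrite integral_cst//= mul1e lebesgue_measure_itv/= lte_fin.
by case: ltP => [_|ba]; [rewrite EFinB|congr EFin; lra].
Qed.

Lemma unif_capI A : measurable A -> unif A = unif (A `&` `[0, 1[%classic).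
Proof.
move=> mA; have mI : measurable (`[0, 1[%classic : set (measurableTypeR R)).
  exact: measurable_itv.
have mD : measurable (A `\` (`[0, 1[%classic : set (measurableTypeR R))).
  exact: measurableD.
have D0 : unif (A `\` `[0, 1[%classic) = 0%E.
  apply: (subset_measure0 mD (measurableC mI)) => [x []//|].
  rewrite [LHS]probability_setC//; have -> := unif_itv (a := 0) (b := 1).
  - by rewrite subr0 subee.
  - by rewrite lexx ler01.
  - by [].
have := measureDI unif mA mI.
by rewrite [X in (X + _)%E]D0 add0e.
Qed.

Let glue (s : seq bool) (B : nat -> set bool) i : set bool :=
  if (i < size s)%N then [set nth false s i] else B i.

Let nu0 : probability Omega R := distribution unif digits.

Lemma nu0_word s B : nu0 (box (size s) (glue s B)) = ((2^-1) ^+ size s)%:E.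
Proof.
rewrite /nu0/= /distribution /pushforward unif_capI; last first.
  rewrite -[X in measurable X]setTI.
  exact: measurable_digits (measurable_box _ _).
have [a [a0 a1 wE]] := wordE s.
have -> : digits @^-1` box (size s) (glue s B) `&` `[0, 1[%classic = word s.
  apply/seteqP; split => x /=; rewrite in_itv/=.
    move=> [H x01]; split => // i is_; have := H i is_.
    by rewrite /glue is_.
  by move=> [x01 H]; split => // i is_; rewrite /glue is_/= H.
have l0 : 0 <= (2^-1 : R) ^+ size s by rewrite exprn_ge0// invr_ge0.
by rewrite wE unif_itv; [congr EFin|lra|lra]; lra.
Qed.

Lemma bernoulli_half B : bernoulli_prob (2^-1 : R) B =
  ((2^-1 * (true \in B)%:R)%:E + (2^-1 * (false \in B)%:R)%:E)%E.
Proof.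
rewrite bernoulli_probE; last by lra.
rewrite !diracE -!EFinM /unstable.onem; congr (_ + _%:E)%E; congr (_ * _); lra.
Qed.

Lemma nu0_glue s k B : nu0 (box (size s + k) (glue s B)) =
  (((2^-1) ^+ size s)%:E *
   \prod_(i < k) bernoulli_prob 2^-1 (B (size s + i)%N))%E.
Proof.
elim: k s => [|k IH] s; first by rewrite addn0 big_ord0 mule1 nu0_word.
pose E c := box (size s + k.+1) (glue (rcons s c) B).
have nuE c : nu0 (E c) = (((2^-1) ^+ (size s).+1)%:E *
    \prod_(i < k) bernoulli_prob 2^-1 (B (size s + i.+1)%N))%E.
  have := IH (rcons s c); rewrite size_rcons addSnnS => ->.
  by congr (_ * _)%E; apply: eq_bigr => i _; rewrite addSnnS.
have mE c b : measurable (if b then E c else set0 : set Omega).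
  by case: b => //; exact: measurable_box.
have -> : box (size s + k.+1) (glue s B) =
    (if true \in B (size s) then E true else set0) `|`
    (if false \in B (size s) then E false else set0).
  have EP c w : E c w <-> w (size s) = c /\
      forall i, (i < size s + k.+1)%N -> i != size s -> glue s B i (w i).
    rewrite /E /box /glue/= size_rcons; split.
      move=> H; split.
        have := H (size s); rewrite ltnS leqnn nth_rcons ltnn eqxx /=; apply.
        by rewrite addnS ltnS leq_addr.
      move=> i ik si; have := H i ik; rewrite ltnS leq_eqVlt (negbTE si)/=.
      by case: ifP => // is_; rewrite nth_rcons is_.
    move=> [ws H] i ik; rewrite ltnS leq_eqVlt nth_rcons.
    case: eqVneq => [->|si] /=; first by rewrite ltnn.
    by have := H i ik si; case: ifP.
  apply/seteqP; split => w.
    move=> H.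
    have Bw : w (size s) \in B (size s).
      have := H (size s); rewrite /glue ltnn inE; apply.
      by rewrite addnS ltnS leq_addr.
    have EH : E (w (size s)) w by apply/EP; split => // i ik _; exact: H.
    by move: Bw EH; case: (w (size s)) => Bw EH; [left|right]; rewrite Bw.
  have gl c : c \in B (size s) -> E c w -> box (size s + k.+1) (glue s B) w.
    move=> Bc /EP[ws H] i ik; have [->|] := eqVneq i (size s); last exact: H.
    by rewrite /glue ltnn ws; rewrite inE in Bc.
  by case; case: ifP => // Bc; exact: gl.
rewrite measureU//; last first.
  apply/seteqP; split => // w [].
  case: ifP => // _; case: ifP => // _.
  move=> /(_ (size s)) + /(_ (size s)).
  rewrite /glue !size_rcons leqnn !nth_rcons ltnn eqxx addnS ltnS leq_addr /=.
  by move=> /(_ erefl) -> /(_ erefl).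
rewrite big_ord_recl bernoulli_half addn0.
set p := (\prod_(i < k) _)%E in nuE *.
have ifE c (b : bool) : nu0 (if b then E c else set0) =
    ((2^-1 ^+ size s * 2^-1 * b%:R)%:E * p)%E.
  case: b; rewrite ?mulr1 ?mulr0 ?mul0e ?measure0//.
  by rewrite nuE exprSr.
rewrite [LHS](congr2 (fun x y : \bar R => (x + y)%E) (ifE _ _) (ifE _ _)) muleA -ge0_muleDl; last 2 first.
- by rewrite lee_fin !mulr_ge0// ?exprn_ge0// invr_ge0.
- by rewrite lee_fin !mulr_ge0// ?exprn_ge0// invr_ge0.
by rewrite -!EFinD -EFinM mulrDr !mulrA.
Qed.

Lemma fair_bernoulli_exists : exists nu, is_fair_bernoulli nu.
Proof.
exists nu0 => n B; have := nu0_glue [::] n B.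
rewrite add0n expr0 mul1e => <-; congr (nu0 _).
Qed.

Lemma fair_bernoulli_unique nu1 nu2 :
  is_fair_bernoulli nu1 -> is_fair_bernoulli nu2 ->
  forall A, measurable A -> nu1 A = nu2 A.
Proof.
move=> h1 h2; pose G : set (set Omega) := [set A | exists n B, A = box n B].
have GT : box 0 (fun=> setT) = setT by apply/seteqP; split => // w _ i.
apply: (measure_unique G (fun=> setT)).
- apply/seteqP; split.
    apply: smallest_sub; first exact: smallest_sigma_algebra.
    move=> _ [i [B ->]]; apply: sub_sigma_algebra.
    exists i.+1, (fun j => if j == i then B else setT).
    apply/seteqP; split => w /=; last by move=> /(_ i (leqnn _)); rewrite eqxx.
    by move=> Bi j _; case: eqP => [->|].
  apply: smallest_sub; first exact: smallest_sigma_algebra.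
  by move=> _ [n [B ->]]; exact: measurable_box.
- move=> _ _ [n [B ->]] [m [C ->]].
  exists (maxn n m), (fun i => (if (i < n)%N then B i else setT) `&`
    (if (i < m)%N then C i else setT)).
  apply/seteqP; split => w /=.
    by move=> [Hn Hm] i _; split; case: ifP => // ?; [exact: Hn|exact: Hm].
  move=> H; split => i im; have := H i; rewrite leq_max im ?orbT.
    by move=> /(_ erefl) [].
  by move=> /(_ erefl) [].
- by move=> _; exists 0%N, (fun=> setT).
- by rewrite bigcup_const//; exists 0%N.
- by move=> _ [n [B ->]]; exact: etrans (h1 n B) (esym (h2 n B)).
- by move=> _; rewrite [X in (X < _)%E](probability_setT nu1) ltry.
Qed.

Definition fair_bernoulli : probability Omega R :=
  projT1 (cid fair_bernoulli_exists).

Lemma fair_bernoulliP : is_fair_bernoulli fair_bernoulli.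
Proof. exact: projT2 (cid fair_bernoulli_exists). Qed.

End fair_bernoulli.

Definition cantor_map (R : realType) (b : nat) (w : Omega) : R :=
  limn (series (fun j => 2 * (w j)%:R / b%:R ^+ j.+1 : R)).

Section cantor_measure.
Variables (R : realType) (b : nat).

Let digit (j : nat) (w : Omega) : R := 2 * (w j)%:R / b%:R ^+ j.+1.

Lemma is_cvg_cantor_map w : (1 < b)%N -> cvgn (series (digit ^~ w)).
Proof.
move=> b1; have b0 : 1 < b%:R :> R by rewrite ltr1n.
apply: (series_le_cvg (v_ := geometric (2 / b%:R) (b%:R^-1))) => [j|j|j|].
- by rewrite divr_ge0 ?mulr_ge0 ?exprn_ge0.
- by rewrite /= mulr_ge0 ?exprn_ge0 ?divr_ge0 ?invr_ge0.
- rewrite /digit /= exprS invfM exprVn mulrA ler_wpM2r ?invr_ge0 ?exprn_ge0//.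
  by rewrite ler_wpM2r ?invr_ge0// ger_pMr// lern1 leq_b1.
- apply: is_cvg_geometric_series.
  by rewrite ger0_norm ?invr_ge0// invf_lt1// (lt_trans ltr01 b0).
Qed.

Lemma cantor_map_eseries w :
  @cantor_map R b w = fine (\sum_(0 <= j <oo) (digit j w)%:E)%E.
Proof.
have d0 j : 0 <= digit j w by rewrite divr_ge0 ?mulr_ge0 ?exprn_ge0.
have cE : cvgn (fun n => \sum_(0 <= j < n) (digit j w)%:E)%E.
  by apply: is_cvg_nneseries => j _ _; rewrite lee_fin.
have sE n : (\sum_(0 <= j < n) (digit j w)%:E)%E =
    (series (digit ^~ w) n)%:E by rewrite sumEFin.
rewrite /cantor_map -/(digit ^~ w).
have [cvs|dvs] := pselect (cvgn (series (digit ^~ w))).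
  by rewrite (eq_fun sE) EFin_lim.
rewrite dvgP//.
case E : (limn _) => [r| |] //; exfalso; apply: dvs.
move: cE => /cvg_ex[/= l cl]; move: E; rewrite (cvg_lim _ cl)// => lr.
move: cl; rewrite lr => cl; apply/cvg_ex; exists r.
have -> : series (digit ^~ w) =
    fine \o (fun n => \sum_(0 <= j < n) (digit j w)%:E)%E.
  by apply/funext => n /=; rewrite sE.
exact: fine_cvg cl.
Qed.

Lemma measurable_cantor_map : measurable_fun [set: Omega] (@cantor_map R b).
Proof.
rewrite (funext cantor_map_eseries); apply: measurableT_comp => //.
apply: ge0_emeasurable_sum => [j w _ _|j _].
  by rewrite lee_fin divr_ge0 ?mulr_ge0 ?exprn_ge0.
apply/measurable_EFinP; apply: measurable_funM => //.
apply: measurable_funM => //.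
have mj : measurable_fun [set: Omega] (fun w => w j).
  move=> _ B _; rewrite setTI.
  by apply: sub_sigma_algebra; exists j, B.
exact: (measurableT_comp (f := fun c : bool => c%:R : R) _ mj).
Qed.

HB.instance Definition _ :=
  isMeasurableFun.Build _ _ Omega R (@cantor_map R b) measurable_cantor_map.

Definition cantor_measure : probability R R :=
  distribution (fair_bernoulli R) (@cantor_map R b).

End cantor_measure.

Section fourier_frame.
Variables (R : realType) (mu : probability R R).
Local Open Scope complex_scope.

(* exp (i t) for real t *)
Definition expi (t : R) : R[i] := cos t +i* sin t.

Definition sqnorm (f : R -> R[i]) : \bar R :=
  (\int[mu]_x ((normc (f x)) ^+ 2)%:E)%E.

Definition L2 (f : R -> R[i]) : Prop :=
  [/\ measurable_fun setT (fun x => complex.Re (f x)),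
      measurable_fun setT (fun x => complex.Im (f x)) &
      (sqnorm f < +oo)%E].

(* The library integrates real-valued functions only. *)
Definition cintegral (f : R -> R[i]) : R[i] :=
  (\int[mu]_x complex.Re (f x))%R +i* (\int[mu]_x complex.Im (f x))%R.

Definition is_fourier_frame (Lambda : set R) : Prop :=
  exists A B : R, [/\ 0 < A, A <= B &
    forall f, L2 f ->
      (A%:E * sqnorm f <=
         \esum_(l in Lambda)
           ((normc (cintegral (fun x => f x * expi (- 2 * pi * l * x)))) ^+ 2)%:E
       <= B%:E * sqnorm f)%E].

Definition admits_fourier_frame : Prop :=
  exists Lambda : set R, countable Lambda /\ is_fourier_frame Lambda.

End fourier_frame.

(* Main.v *)
Require Import Defs.
From HB Require Import structures.
From mathcomp Require Import all_boot all_order all_algebra.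
From mathcomp Require Import all_classical all_reals all_analysis.
From mathcomp Require Import measurable_realfun.
From mathcomp Require Import complex finmap.
From mathcomp Require Import ring lra.

(** Suppose that the measure has a frame spectrum [L] with bounds [A <= B], and
    compare the Fourier weights [|f^(l)|^2] of three unimodular functions: the
    constant 1, the sign [(-1)^(w (j+1))] of one digit, and the product of the
    signs of two consecutive digits [j] and [j+1].  As the digits are
    independent, the transform of such a function is a product with one factor
    per digit: with [t = 2 pi l / b^(j+2)],

      - 1 has weight                [W = cos^2 t * cos^2 (b t) * u],
      - the single sign has weight  [V = sin^2 t * cos^2 (b t) * u],
      - the double sign has weight  [U = sin^2 t * sin^2 (b t) * u],

    where [u] comes from the other digits.  The sum of each weight over [L] lies
    between [A] and [B].  The weights [V] move to infinity as [j] grows, because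
    [t] tends to 0 for fixed [l]; the weights [W] do not depend on [j], so
    their sum over the [l] that matter for [V] becomes small.  Where [V] is much
    larger than [W], [t] must be close to a zero of the cosine.  For odd [b],
    multiplication by [b] maps the zeros of the cosine to zeros of the cosine,
    so [cos (b t)] is small there too and [U] is much larger than [V]: the sum
    of [U] would exceed [B].

    Quantitatively, [cos^2 (b t) <= b^2 cos^2 t] ([cos2_odd_mulr_le]) and the
    arithmetic-geometric mean inequality give [2 V <= r b^2 W + (V + U) / r]
    for all [r > 0] ([mixed_weight_le]).  Summed over a tail of [L], with [r] of
    size [B / A], this makes the sum of [V] smaller than [A]
    ([no_three_frame_sums]).  The product formula is [sqr_fourier_walsh]; its
    only probabilistic input is that flipping one digit preserves the fair
    Bernoulli measure ([fair_bernoulli_flip]). *)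

Import Order.TTheory GRing.Theory Num.Theory.
Import numFieldNormedType.Exports.
Import Normc.

Set Implicit Arguments.
Unset Strict Implicit.
Unset Printing Implicit Defensive.

Local Open Scope classical_set_scope.
Local Open Scope ring_scope.
Local Open Scope complex_scope.

(** * Sums over an index set and over its finite subsets *)

Section sums.
Variables (R : realType) (T : choiceType) (L : set T).
Implicit Types (W : T -> R) (X Y : {fset T}) (c : R).

Lemma sum_le_esum W X c : [set` X] `<=` L ->
  (\esum_(x in L) (W x)%:E <= c%:E)%E -> \sum_(x <- X) W x <= c.
Proof.
move=> XL WB; rewrite -lee_fin; apply: le_trans WB; apply: esum_ge.
by exists [set` X]; [split|rewrite fsbig_finite//= set_fsetK sumEFin].
Qed.

Lemma esum_gt_sum W c : (c%:E < \esum_(x in L) (W x)%:E)%E ->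
  exists2 X : {fset T}, [set` X] `<=` L & c < \sum_(x <- X) W x.
Proof.
move=> /ereal_sup_gt[_ [_ [/finite_fsetP[X ->] XL] <-] cX]; exists X => //.
by rewrite fsbig_finite//= set_fsetK sumEFin lte_fin in cX.
Qed.

Lemma small_tail W c (e : R) : (forall x, 0 <= W x) -> 0 < e ->
    (\esum_(x in L) (W x)%:E <= c%:E)%E ->
  exists2 X : {fset T}, [set` X] `<=` L & forall Y, [set` Y] `<=` L ->
    \sum_(x <- (Y `\` X)%fset) W x <= e.
Proof.
move=> W0 e0 Wc; pose S := fine (\esum_(x in L) (W x)%:E).
have SE : (\esum_(x in L) (W x)%:E)%E = S%:E.
  rewrite fineK// ge0_fin_numE; first exact: le_lt_trans Wc (ltry _).
  by apply: esum_ge0 => x _; rewrite lee_fin.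
have [|X XL SX] := @esum_gt_sum W (S - e).
  by rewrite SE lte_fin ltrBlDr ltrDl.
exists X => // Y YL.
have XYL : [set` (X `|` Y)%fset] `<=` L.
  by move=> x /=; rewrite in_fsetU => /orP[/XL|/YL].
have := sum_le_esum XYL (eq_ind_r (fun z => (z <= S%:E)%E) (lexx _) SE).
rewrite (big_fsetID _ (mem X))/=.
have -> : [fset x in (X `|` Y)%fset | x \in X]%fset = X.
  by apply/fsetP => x; rewrite !inE/=; case: (x \in X); rewrite ?andbF.
have -> : [fset x in (X `|` Y)%fset | x \notin X]%fset = (Y `\` X)%fset.
  by apply/fsetP => x; rewrite !inE/=; case: (x \in X); rewrite ?andbF ?andbT.
lra.
Qed.

(** The function [V j] leaves every finite set as [j] grows, so its sum is
    carried by a tail of [L] on which [W] is negligible.  On that tail the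
    hypothesis on [V], [W] and [U] leaves only [(V + U) / t], whose sum is at
    most [2 * B / t]: too little once [t] is a large multiple of [B / A]. *)
Lemma no_three_frame_sums (W : T -> R) (V U : nat -> T -> R) (A B beta : R) :
  0 < A -> A <= B -> 0 < beta ->
  (forall x, 0 <= W x) -> (forall j x, 0 <= V j x) ->
  (\esum_(x in L) (W x)%:E <= B%:E)%E ->
  (forall j, A%:E <= \esum_(x in L) (V j x)%:E <= B%:E)%E ->
  (forall j, \esum_(x in L) (U j x)%:E <= B%:E)%E ->
  (forall x, L x -> V ^~ x @ \oo --> 0) ->
  (forall j x (t : R), 0 < t ->
     2 * V j x <= t * beta * W x + (V j x + U j x) / t) ->
  False.
Proof.
move=> A0 AB beta0 W0 V0 WB VB UB Vcvg ineq.
have B0 : 0 < B by exact: lt_le_trans AB.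
(* [t] and [e] make each of the two terms of the bound at most [A / 4]. *)
pose t := 8 * B / A; pose e := A / (4 * (t * beta)).
have t0 : 0 < t by rewrite divr_gt0 ?mulr_gt0.
have tb0 : 0 < t * beta by exact: mulr_gt0.
have e0 : 0 < e by apply: divr_gt0 => //; exact: mulr_gt0.
have [X XL tail] := small_tail W0 e0 WB.
have [j Vj] : exists j, \sum_(x <- X) V j x < A / 4.
  have : \sum_(x <- X | x \in X) V j x @[j --> \oo] -->
      \sum_(x <- X | x \in X) (0 : R).
    apply: cvg_big => [|x xX]; first exact: add_continuous.
    by apply: Vcvg; exact: XL.
  rewrite big1// => sum0; have lt0 := cvgr_lt _ sum0.
  have [|j _ Vj] := lt0 _ (A / 4).
    by rewrite divr_gt0.
  by exists j; rewrite big_seq; exact: Vj (leqnn j).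
have [|Y YL VY] := @esum_gt_sum (V j) (3 / 4 * A).
  by have /andP[AV _] := VB j; apply: lt_le_trans AV; rewrite lte_fin; lra.
pose Z := (Y `\` X)%fset.
have ZL : [set` Z] `<=` L by move=> x /=; rewrite in_fsetD => /andP[_ /YL].
have VZ : \sum_(x <- Z) V j x <= B.
  by have /andP[_] := VB j; exact: sum_le_esum.
have UZ : \sum_(x <- Z) U j x <= B by exact: sum_le_esum (UB j).
have : \sum_(x <- Y) V j x <= \sum_(x <- X) V j x + \sum_(x <- Z) V j x.
  rewrite (big_fsetID _ (mem X))/=.
  have -> : [fset x in Y | x \notin X]%fset = Z.
    by apply/fsetP => x; rewrite !inE andbC.
  rewrite lerD2r [leRHS](big_fsetID _ (mem Y))/=.
  have -> : [fset x in X | x \in Y]%fset = [fset x in Y | x \in X]%fset.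
    by apply/fsetP => x; rewrite !inE andbC.
  by rewrite lerDl sumr_ge0.
have : 2 * \sum_(x <- Z) V j x <= t * beta * \sum_(x <- Z) W x +
    (\sum_(x <- Z) V j x + \sum_(x <- Z) U j x) / t.
  rewrite !mulr_sumr -big_split/= mulr_suml -big_split/=.
  by apply: ler_sum => x _; exact: ineq.
have WZ : t * beta * \sum_(x <- Z) W x <= A / 4.
  have -> : A / 4 = t * beta * e by rewrite /e; field; rewrite !gt_eqF.
  by rewrite ler_pM2l// tail.
have VUZ : (\sum_(x <- Z) V j x + \sum_(x <- Z) U j x) / t <= A / 4.
  have -> : A / 4 = (B + B) / t by rewrite /t; field; rewrite !gt_eqF.
  by rewrite ler_pM2r ?invr_gt0// lerD.
lra.
Qed.
End sums.

(** * Trigonometric and complex identities *)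

Section complex_lemmas.
Variable R : realType.
Implicit Types (x y : R[i]) (t u : R).

Lemma normc2E x : normc x ^+ 2 = complex.Re x ^+ 2 + complex.Im x ^+ 2.
Proof. by case: x => a c; rewrite /normc/= sqr_sqrtr// addr_ge0// sqr_ge0. Qed.

Lemma normc_sign (c : bool) : normc ((-1) ^+ c : R[i]) = 1.
Proof. by case: c; rewrite ?expr1 ?expr0 ?normcN normc1. Qed.

Lemma normc_expi t : normc (expi t) = 1.
Proof. by rewrite /normc/= cos2Dsin2 sqrtr1. Qed.

Lemma expiD t u : expi (t + u) = expi t * expi u.
Proof.
rewrite /expi cosD sinD; apply/eqP; rewrite eq_complex/=.
by apply/andP; split; apply/eqP; ring.
Qed.

(** The squared modulus of the mean of 1 and [(-1)^s * expi (- 2 t)], which is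
    the contribution of one digit, with or without its sign, to a Fourier
    weight. *)
Definition cos2_sin2 (s : bool) t : R := if s then sin t ^+ 2 else cos t ^+ 2.

Lemma normc_half_sign_expi (s : bool) t :
  normc ((1 + (-1) ^+ s * expi (- (2 * t))) / 2) ^+ 2 = cos2_sin2 s t.
Proof.
pose z := if s then sin t ^+ 2 +i* (sin t * cos t)
          else cos t ^+ 2 -i* (sin t * cos t).
have -> : 1 + (-1) ^+ s * expi (- (2 * t)) = 2 * z.
  rewrite /expi cosN sinN [2 * t]mulr_natl mulr2n cosD sinD.
  have := cos2Dsin2 t; rewrite /z !expr2 => cs; apply/eqP; rewrite eq_complex.
  by case: s @z => /=; apply/andP; split; apply/eqP; lra.
rewrite mulrC mulKf ?pnatr_eq0// normc2E /z; have := cos2Dsin2 t.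
move=> cs; rewrite /cos2_sin2; case: s @z => _ /=.
  by rewrite -[RHS]mulr1 -cs; ring.
by rewrite -[RHS]mulr1 -cs; ring.
Qed.

(** For odd [b] the zeros of the cosine are zeros of [cos (b t)]; the induction
    uses [cos ((n + 2) t) = 2 cos t cos ((n + 1) t) - cos (n t)]. *)
Lemma cos_odd_mulr_le (b : nat) t :
  odd b -> `|cos (b%:R * t)| <= b%:R * `|cos t|.
Proof.
move=> ob; rewrite -(odd_double_half b) ob add1n; elim: b./2 => [|k IH].
  by rewrite !mul1r.
have -> : cos (k.+1.*2.+1%:R * t) =
    2 * cos t * cos (k.*2.+2%:R * t) - cos (k.*2.+1%:R * t).
  have -> : k.*2.+2%:R * t = k.*2.+1%:R * t + t by rewrite -[in LHS]natr1; ring.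
  have -> : k.+1.*2.+1%:R * t = k.*2.+1%:R * t + t + t.
    by rewrite doubleS -2![in LHS]natr1; ring.
  set u := k.*2.+1%:R * t; rewrite !(cosD, sinD); apply/eqP.
  rewrite -subr_eq0 (_ : _ - _ = cos u * (1 - (cos t ^+ 2 + sin t ^+ 2))).
    by rewrite cos2Dsin2 subrr mulr0.
  by ring.
apply: (le_trans (ler_normB _ _)); rewrite !normrM ger0_norm//.
have -> : k.+1.*2.+1%:R = 2 + k.*2.+1%:R :> R.
  by rewrite doubleS -addn2 natrD addrC.
rewrite [leRHS]mulrDl lerD// ler_piMr ?mulr_ge0//.
by rewrite ler_norml cos_geN1 cos_le1.
Qed.

Lemma cos2_odd_mulr_le (b : nat) t : odd b ->
  cos2_sin2 false (b%:R * t) <= b%:R ^+ 2 * cos2_sin2 false t.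
Proof.
move=> ob; rewrite /cos2_sin2 -[cos (_ * _) ^+ 2]real_normK ?num_real//.
rewrite -[cos t ^+ 2]real_normK ?num_real// -exprMn.
by rewrite ler_pXn2r ?nnegrE ?mulr_ge0// cos_odd_mulr_le.
Qed.

Lemma cos2_sin2_ge0 s t : 0 <= cos2_sin2 s t.
Proof. by case: s; exact: sqr_ge0. Qed.

Lemma cos2_sin2_true t : cos2_sin2 true t = 1 - cos2_sin2 false t.
Proof. by rewrite /cos2_sin2 -(cos2Dsin2 t) addrAC subrr add0r. Qed.

End complex_lemmas.

(** * Expectation of unimodular functions *)

Section phases.
Variables (R : realType) (d : measure_display) (T : measurableType d).
Variable P : probability T R.
Implicit Types (f g : T -> R[i]).

Definition phase f : Prop :=
  [/\ measurable_fun setT (fun x => complex.Re (f x)),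
      measurable_fun setT (fun x => complex.Im (f x)) &
      forall x, normc (f x) = 1].

Definition cexpectation f : R[i] :=
  (\int[P]_x complex.Re (f x))%R +i* (\int[P]_x complex.Im (f x))%R.

Lemma phase_sign (c : T -> bool) : measurable_fun setT c ->
  phase (fun x => (-1) ^+ c x).
Proof.
move=> mc; split; last by move=> x; exact: normc_sign.
- pose re (e : bool) : R := complex.Re ((-1) ^+ e).
  exact: (measurableT_comp (f := re) _ mc).
- pose im (e : bool) : R := complex.Im ((-1) ^+ e).
  exact: (measurableT_comp (f := im) _ mc).
Qed.

Lemma phase_expi (t : T -> R) : measurable_fun setT t ->
  phase (fun x => expi (t x)).
Proof.
move=> mt; split => /=; last by move=> x; exact: normc_expi.
- apply: measurableT_comp => //.
  exact: continuous_measurable_fun (@continuous_cos R).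
- apply: measurableT_comp => //.
  exact: continuous_measurable_fun (@continuous_sin R).
Qed.

Lemma phaseM f g : phase f -> phase g -> phase (fun x => f x * g x).
Proof.
move=> [rf jf nf] [rg jg ng]; split => [| |x].
- rewrite (_ : (fun x => _) = fun x => complex.Re (f x) * complex.Re (g x) -
      complex.Im (f x) * complex.Im (g x)).
    by apply: measurable_funB; exact: measurable_funM.
  by apply/funext => x; case: (f x) (g x) => ? ? [].
- rewrite (_ : (fun x => _) = fun x => complex.Re (f x) * complex.Im (g x) +
      complex.Im (f x) * complex.Re (g x)).
    by apply: measurable_funD; exact: measurable_funM.
  by apply/funext => x; case: (f x) (g x) => ? ? [].
- by rewrite normcM nf ng mulr1.
Qed.

Lemma phase_integrable f : phase f ->
  P.-integrable setT (EFin \o (fun x => complex.Re (f x))) /\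
  P.-integrable setT (EFin \o (fun x => complex.Im (f x))).
Proof.
move=> [rf jf nf].
have le1 (g : T -> R) : measurable_fun setT g -> (forall x, g x ^+ 2 <= 1) ->
    P.-integrable setT (EFin \o g).
  move=> mg g1; apply: measurable_bounded_integrable => //.
    by rewrite -ge0_fin_numE//; exact: fin_num_measure.
  exists 1; split=> // M M1 x _ /=; apply: ltW; apply: le_lt_trans M1.
  by rewrite -(@ler_pXn2r _ 2)// ?nnegrE// expr1n -normrX ger0_norm ?sqr_ge0.
have := fun x => normc2E (f x).
by move=> fE; split; apply: le1 => // x; have := fE x; rewrite nf expr1n => ->;
  rewrite ?lerDl ?lerDr sqr_ge0.
Qed.

Lemma cexpectationD f g : phase f -> phase g ->
  cexpectation (fun x => f x + g x) = cexpectation f + cexpectation g.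
Proof.
move=> /phase_integrable[rf jf] /phase_integrable[rg jg].
apply/eqP; rewrite eq_complex/=; apply/andP; split; apply/eqP.
- by rewrite -RintegralD//; apply: eq_Rintegral => x _; rewrite raddfD.
- by rewrite -RintegralD//; apply: eq_Rintegral => x _; rewrite raddfD.
Qed.

Lemma cexpectationZ (c : R[i]) f : phase f ->
  cexpectation (fun x => c * f x) = c * cexpectation f.
Proof.
case: c => a e /phase_integrable[rf jf].
have aZ (r : R) (h : T -> R) : P.-integrable setT (EFin \o h) ->
    P.-integrable setT (EFin \o (fun x => r * h x)).
  by move=> hi; exact: (integrableZl measurableT r hi).
apply/eqP; rewrite eq_complex/=; apply/andP; split; apply/eqP.
- rewrite -!RintegralZl// -RintegralB;
    [|exact: measurableT|exact: aZ|exact: aZ].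
  by apply: eq_Rintegral => x _; case: (f x).
- rewrite -!RintegralZl// -RintegralD;
    [|exact: measurableT|exact: aZ|exact: aZ].
  by apply: eq_Rintegral => x _; case: (f x).
Qed.

End phases.

Section change_of_variables.
Variables (R : realType) (d d' : measure_display).
Variables (T : measurableType d) (S : measurableType d').

Lemma phase_comp (Y : T -> S) (g : S -> R[i]) :
  measurable_fun setT Y -> phase g -> phase (fun x => g (Y x)).
Proof.
by move=> mY [rg jg ng]; split => // ; [exact: (measurableT_comp rg mY)|
  exact: (measurableT_comp jg mY)].
Qed.

Lemma cexpectation_distribution (P : probability T R) (Y : {mfun T >-> S})
    (g : S -> R[i]) : phase g ->
  cexpectation (distribution P Y) g = cexpectation P (fun x => g (Y x)).
Proof.
move=> pg; have pgY := phase_comp (measurable_funP Y) pg.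
have [rgY jgY] := phase_integrable P pgY; case: pg => rg jg _.
rewrite /cexpectation /Rintegral !integral_distribution//;
  exact/measurable_EFinP.
Qed.

End change_of_variables.
(** * Flipping one digit *)

Section flip.
Variable R : realType.
Local Notation nu := (fair_bernoulli R).

Definition flip (i : nat) (w : Omega) : Omega :=
  fun j => if j == i then ~~ w j else w j.

Lemma measurable_coord (i : nat) :
  measurable_fun [set: Omega] (fun w : Omega => w i).
Proof.
by move=> _ B _; rewrite setTI; apply: sub_sigma_algebra; exists i, B.
Qed.

Lemma flipE i w j : flip i w j = if j == i then ~~ w j else w j.
Proof. by []. Qed.

Lemma measurable_flip i : measurable_fun [set: Omega] (flip i).
Proof.
have mO : @measurable _ Omega = <<s cylinders >> by [].
apply: (measurability _ mO) => _ [_ [j [B ->]] <-].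
have mj : measurable_fun [set: Omega] (fun w => flip i w j).
  rewrite /flip; case: (j == i); last exact: measurable_coord.
  exact: (measurableT_comp (f := negb) _ (measurable_coord j)).
exact: mj.
Qed.

HB.instance Definition _ i :=
  isMeasurableFun.Build _ _ _ _ (flip i) (measurable_flip i).

Lemma fair_bernoulli_flip i (A : set Omega) : measurable A ->
  distribution nu (flip i) A = nu A.
Proof.
apply: fair_bernoulli_unique => [n B|]; last exact: fair_bernoulliP.
pose B' := fun j => if j == i then negb @^-1` B j else B j.
transitivity (nu (box n B')).
  congr (nu _); apply/seteqP; split => w H j jn; have := H j jn;
  by rewrite /B' /= flipE; case: eqP.
rewrite [LHS](fair_bernoulliP R n B'); apply: eq_bigr => j _.
rewrite /B'; case: eqP => // _; rewrite !bernoulli_half addeC.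
congr (_%:E + _%:E)%E; congr (_ * (nat_of_bool _)%:R);
  by apply/idP/idP; rewrite !inE.
Qed.

Lemma cexpectation_flip i (g : Omega -> R[i]) : phase g ->
  cexpectation nu (fun w => g (flip i w)) = cexpectation nu g.
Proof.
move=> pg; rewrite -(cexpectation_distribution nu (flip i) pg).
by congr (fine _ +i* fine _); apply: eq_measure_integral => A mA _;
  exact: fair_bernoulli_flip.
Qed.

(** Independence of the digit [i] from the rest, in the form that is needed
    here: averaging [phi (w i) * K w] with its flip replaces [phi (w i)] by the
    mean of [phi]. *)
Lemma cexpectation_factor i (phi : bool -> R[i]) (K : Omega -> R[i]) :
  (forall c, normc (phi c) = 1) -> phase K -> (forall w, K (flip i w) = K w) ->
  cexpectation nu (fun w => phi (w i) * K w) =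
  (phi false + phi true) / 2 * cexpectation nu K.
Proof.
move=> phi1 pK Ki; pose G (w : Omega) := phi (w i) * K w.
rewrite -[X in cexpectation _ X]/G.
have pG : phase G.
  apply: phaseM => //; apply: (phase_comp (measurable_coord i)).
  by split.
have pGi := phase_comp (measurable_flip i) pG.
apply: (@mulfI _ 2); rewrite ?pnatr_eq0//.
rewrite mulrA mulrCA mulfV ?pnatr_eq0// mulr1 mulr_natl mulr2n.
rewrite -{2}(cexpectation_flip i pG) -cexpectationD// -cexpectationZ//.
congr cexpectation; apply/funext => w; rewrite /G Ki -mulrDl /flip eqxx.
by case: (w i) => //=; rewrite addrC.
Qed.

End flip.

(** * Digits of a point of the Cantor set *)

Section digits.
Variables (R : realType) (b : nat).
Hypothesis b_gt2 : (2 < b)%N.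
Local Notation nu := (fair_bernoulli R).
Local Notation cmap := (@cantor_map R b).

Let b_gt0 : 0 < b%:R :> R. Proof. by rewrite ltr0n (ltn_trans _ b_gt2). Qed.

Lemma cantor_mapS (w : Omega) :
  cmap w = (2 * (w 0%N)%:R + cmap (fun j => w j.+1)) / b%:R.
Proof.
have cvg (v : Omega) := @is_cvg_cantor_map R b v (ltn_trans (ltnSn 1) b_gt2).
apply/cvg_lim => //; rewrite -(cvg_shiftn 1) mulrDl.
rewrite (_ : (fun n => _) = fun n => 2 * (w 0%N)%:R / b%:R +
  series (fun j => 2 * (w j.+1)%:R / b%:R ^+ j.+1 : R) n / b%:R); last first.
  apply/funext => n; rewrite /series/= addn1 big_nat_recl// expr1.
  congr (_ + _); rewrite mulr_suml; apply: eq_bigr => j _.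
  by rewrite [in LHS]exprSr invfM mulrA.
by apply: cvgD; [exact: cvg_cst|apply: cvgMl; exact: (cvg (fun j => w j.+1))].
Qed.

Lemma cantor_map_le1 (w : Omega) : 0 <= cmap w <= 1.
Proof.
have cvg := @is_cvg_cantor_map R b w (ltn_trans (ltnSn 1) b_gt2).
apply/andP; split.
  apply: limr_ge => //; apply: nearW => n; apply: sumr_ge0 => j _.
  by rewrite divr_ge0 ?mulr_ge0 ?exprn_ge0// ltW.
apply: limr_le => //; apply: nearW => n.
(* This stronger bound passes from [n] to [n.+1] because [2 <= b - 1]. *)
apply: (@le_trans _ _ (1 - b%:R ^- n)); last first.
  by rewrite gerBl invr_ge0 exprn_ge0 ?ltW.
rewrite /series/=; elim: n => [|n IH].
  by rewrite big_geq// expr0 invr1 subrr.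
rewrite big_nat_recr//=; apply: (le_trans (lerD IH (lexx _))).
have -> : b%:R ^- n = b%:R * b%:R ^- n.+1 :> R.
  by rewrite exprS invfM mulrA divff ?mul1r// gt_eqF.
have : 0 < b%:R ^- n.+1 :> R by rewrite invr_gt0 exprn_gt0.
have : 3 <= b%:R :> R by rewrite ler_nat.
by case: (w n); rewrite ?mulr1n ?mulr0n; set x := _ ^- _; nra.
Qed.

(** The test functions must be functions of the point, not of its code: the
    digits are read off as with an expansion in base [b] whose first digit is 1
    exactly on the right of the gap of the Cantor set that ends at [2 / b]. *)
Definition digit_shift (x : R) : R :=
  if 2 / b%:R <= x then b%:R * x - 2 else b%:R * x.

Definition digit_at (j : nat) (x : R) : bool :=
  2 / b%:R <= iter j digit_shift x.

Lemma digit_at_cantor_map j (w : Omega) : digit_at j (cmap w) = w j.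
Proof.
have d0 (v : Omega) : (2 / b%:R <= cmap v) = v 0%N.
  rewrite cantor_mapS ler_pM2r ?invr_gt0//; set y := cmap _.
  have /andP[y0 y1] : 0 <= y <= 1 := cantor_map_le1 _.
  by case: (v 0%N); rewrite ?mulr1n ?mulr0n; [|apply/negP]; lra.
elim: j w => [|j IH] w; first exact: d0.
rewrite /digit_at iterSr -[LHS]/(digit_at j _) -[RHS](IH (fun j => w j.+1)).
congr digit_at; rewrite /digit_shift d0 cantor_mapS.
by case: (w 0%N); rewrite mulrC divfK ?gt_eqF// ?mulr1n ?mulr0n; lra.
Qed.

Lemma measurable_digit_at j : measurable_fun [set: R] (digit_at j).
Proof.
apply: measurable_fun_ler => //.
have mshift : measurable_fun [set: R] digit_shift.
  apply: measurable_fun_ifT.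
  - exact: measurable_fun_ler.
  - by apply: measurable_funB => //; exact: measurable_funM.
  - exact: measurable_funM.
elim: j => [|j IH] /=; first exact: measurable_id.
exact: (measurableT_comp mshift IH).
Qed.

Lemma cantor_map_flip i (w : Omega) :
  cmap (flip i w) - 2 * (flip i w i)%:R / b%:R ^+ i.+1 =
  cmap w - 2 * (w i)%:R / b%:R ^+ i.+1.
Proof.
have step (a x c : R) n : (2 * a + x) / b%:R - c / b%:R ^+ n.+1 =
    (2 * a + (x - c / b%:R ^+ n)) / b%:R.
  by rewrite exprS; field; rewrite expf_neq0 ?gt_eqF.
elim: i w => [|i IH] w; rewrite (cantor_mapS w) (cantor_mapS (flip _ _)) !step.
  by rewrite !expr0 !divr1 !addrA !(addrAC _ _ (- _)) !subrr !add0r.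
by congr ((_ + _) / _); exact: (IH (fun j => w j.+1)).
Qed.

End digits.

(** * Fourier weights of products of two digit signs *)

Section fourier_coef.
Variables (R : realType) (mu : probability R R).

Definition fourier_coef (f : R -> R[i]) (l : R) : R[i] :=
  cintegral mu (fun x => f x * expi (- 2 * pi * l * x)).

Lemma sqnorm_phase (f : R -> R[i]) : phase f -> sqnorm mu f = 1%E.
Proof.
move=> [_ _ f1]; rewrite /sqnorm; under eq_integral do rewrite f1 expr1n.
by rewrite integral_cst// mul1e; exact: probability_setT.
Qed.

Lemma L2_phase (f : R -> R[i]) : phase f -> L2 mu f.
Proof.
by move=> pf; rewrite /L2 sqnorm_phase// ltry; case: pf => rf jf _; split.
Qed.

End fourier_coef.

Section walsh.
Variables (R : realType) (b : nat).
Hypothesis b_gt2 : (2 < b)%N.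
Local Notation nu := (fair_bernoulli R).
Local Notation mu := (cantor_measure R b).
Local Notation cmap := (@cantor_map R b).

Definition walsh (i k : nat) (s s' : bool) (x : R) : R[i] :=
  (-1) ^+ (s && digit_at b i x) * (-1) ^+ (s' && digit_at b k x).

Lemma phase_walsh i k s s' : phase (walsh i k s s').
Proof.
apply: phaseM; apply: phase_sign; apply: measurable_and => //;
  exact: measurable_digit_at.
Qed.

(** One digit at a time: the sum defining [cantor_map] splits off the term of the
    digit [i], then that of the digit [k], and [cexpectation_factor] turns each
    into a factor.  The factor [U] of the other digits does not depend on the
    signs [s] and [s']; that is what makes the weights comparable. *)
Lemma sqr_fourier_walsh (i k : nat) (l : R) : k != i -> exists2 U : R, 0 <= U &
  forall s s', normc (fourier_coef mu (walsh i k s s') l) ^+ 2 =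
    cos2_sin2 s (2 * pi * l / b%:R ^+ i.+1) *
    cos2_sin2 s' (2 * pi * l / b%:R ^+ k.+1) * U.
Proof.
move=> ki; pose theta := - 2 * pi * l.
pose dg j (w : Omega) : R := 2 * (w j)%:R / b%:R ^+ j.+1.
pose fac j (s c : bool) : R[i] :=
  (-1) ^+ (s && c) * expi (theta * (2 * c%:R / b%:R ^+ j.+1)).
have fac1 j s c : normc (fac j s c) = 1.
  by rewrite normcM normc_sign normc_expi mulr1.
have facE j s : normc ((fac j s false + fac j s true) / 2) ^+ 2 =
    cos2_sin2 s (2 * pi * l / b%:R ^+ j.+1).
  rewrite -normc_half_sign_expi /fac andbF andbT expr0 mul1r mulr0 mul0r mulr0.
  rewrite [expi 0](_ : _ = 1) ?/expi ?cos0 ?sin0//.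
  congr (normc ((_ + _ * expi _) / _) ^+ 2).
  by rewrite /theta /= mulr1n; ring.
have mdg j : measurable_fun [set: Omega] (dg j).
  apply: measurable_funM => //; apply: measurable_funM => //.
  pose real_of_bool (c : bool) : R := c%:R.
  exact: (measurableT_comp (f := real_of_bool) _ (measurable_coord j)).
have mc := @measurable_cantor_map R b.
pose K2 (w : Omega) := expi (theta * (cmap w - dg i w - dg k w)).
pose K1 s' (w : Omega) :=
  (-1) ^+ (s' && w k) * expi (theta * (cmap w - dg i w)).
have pK2 : phase K2.
  by apply: phase_expi; apply: measurable_funM => //;
    apply: measurable_funB => //; apply: measurable_funB.
have pK1 s' : phase (K1 s').
  apply: phaseM.
    by apply: phase_sign; apply: measurable_and => //; exact: measurable_coord.
  by apply: phase_expi; apply: measurable_funM => //; apply: measurable_funB.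
have K2f w : K2 (flip k w) = K2 w.
  rewrite /K2 ![_ - dg i _ - _]addrAC /dg (cantor_map_flip R b_gt2).
  by rewrite [flip k w i]flipE eq_sym (negbTE ki).
have K1f s' w : K1 s' (flip i w) = K1 s' w.
  by rewrite /K1 /dg (cantor_map_flip R b_gt2) [flip i w k]flipE (negbTE ki).
exists (normc (cexpectation nu K2) ^+ 2) => [|s s']; first exact: sqr_ge0.
transitivity (normc (cexpectation nu (fun w => fac i s (w i) * K1 s' w)) ^+ 2).
  congr (normc _ ^+ 2).
  rewrite /fourier_coef -[LHS]/(cexpectation (distribution nu cmap) _).
  rewrite cexpectation_distribution.
    congr cexpectation; apply/funext => w.
    rewrite /walsh !digit_at_cantor_map// -/theta /fac /K1 mulrACA -expiD.
    by rewrite -/(dg i w) -mulrDr [dg i w + _]addrC subrK.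
  apply: phaseM; first exact: phase_walsh.
  by apply: phase_expi; exact: measurable_funM.
rewrite cexpectation_factor// normcM exprMn facE -[RHS]mulrA; congr (_ * _).
rewrite (_ : K1 s' = fun w => fac k s' (w k) * K2 w).
  by rewrite cexpectation_factor// normcM exprMn facE.
apply/funext => w; rewrite /K1 /K2 /fac -[RHS]mulrA -expiD -/(dg k w) -mulrDr.
by rewrite [dg k w + _]addrC subrK.
Qed.

End walsh.

(** Since [(1 - a)^2 <= 1 - a] and [a'^2 <= beta * a * a'], this follows from
    [2 * (1 - a) * a' <= r * a'^2 + (1 - a)^2 / r]. *)
Lemma mixed_weight_le (R : realFieldType) (a a' u beta r : R) :
  0 <= a <= 1 -> 0 <= a' <= beta * a -> 0 <= u -> 0 < r ->
  2 * ((1 - a) * a' * u) <=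
  r * beta * (a * a' * u) + ((1 - a) * a' * u + (1 - a) * (1 - a') * u) / r.
Proof.
move=> /andP[a0 a1] /andP[a'0 a'le] u0 r0; rewrite -subr_ge0.
rewrite [leRHS](_ : _ = u * ((r * a' - (1 - a)) ^+ 2 / r) +
  r * (a' * (beta * a - a')) * u + (1 - a) * a * u / r); last first.
  by field; rewrite gt_eqF.
have r_ge0 := ltW r0.
have a'_ge0 : 0 <= beta * a - a' by rewrite subr_ge0.
have a1_ge0 : 0 <= 1 - a by rewrite subr_ge0.
apply: addr_ge0; [apply: addr_ge0|].
- by apply: mulr_ge0 => //; apply: divr_ge0 => //; exact: sqr_ge0.
- by do !apply: mulr_ge0 => //.
- by apply: divr_ge0 => //; do !apply: mulr_ge0 => //.
Qed.

Theorem theorem1p1 (R : realType) (b : nat) (hb1 : (1 < b)%N) (hodd : odd b) :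
  ~ admits_fourier_frame (cantor_measure R b).
Proof.
move=> [L [_ [A [B [A0 AB frame]]]]].
have b_gt2 : (2 < b)%N by case: b hb1 hodd {frame} => [|[|[|]]].
have b0 : 0 < b%:R :> R by rewrite ltr0n ltnW.
pose mu := cantor_measure R b.
pose c j s s' l := normc (fourier_coef mu (walsh b j.+1 j s s') l) ^+ 2 : R.
have frameW j s s' :
    (A%:E <= \esum_(l in L) (c j s s' l)%:E <= B%:E)%E.
  have pw := phase_walsh R b j.+1 j s s'.
  by have := frame _ (L2_phase mu pw); rewrite sqnorm_phase// !mule1.
have c0 j s s' l : 0 <= c j s s' l by exact: sqr_ge0.
pose t j l := 2 * pi * l / b%:R ^+ j.+2 : R.
have cE j l : exists2 u : R, 0 <= u & forall s s',
    c j s s' l = cos2_sin2 s (t j l) * cos2_sin2 s' (b%:R * t j l) * u.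
  have [|u u0 uE] := @sqr_fourier_walsh R b b_gt2 j.+1 j l.
    by rewrite ltn_eqF.
  exists u => // s s'; rewrite /c uE /t; congr (_ * cos2_sin2 _ _ * _).
  by rewrite [in RHS]exprS; field; rewrite expf_neq0 gt_eqF.
pose W := c 0%N false false; pose V j := c j true false.
pose U j := c j true true.
(* Without signs the test function is the constant 1, whatever [j] is. *)
have WE j l : W l = c j false false l by [].
apply: (@no_three_frame_sums R R L W V U A B (b%:R ^+ 2)) => //.
- by rewrite exprn_gt0.
- by move=> *; exact: c0.
- by move=> *; exact: c0.
- by have /andP[] := frameW 0%N false false.
- by move=> j; exact: frameW.
- by move=> j; have /andP[] := frameW j true true.
- move=> l Ll.
  have le_B f : (\esum_(l in L) (f l)%:E <= B%:E)%E -> f l <= B.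
    move=> fB; have := sum_le_esum (X := [fset l]%fset) _ fB.
    by rewrite big_seq_fset1; apply => x /=; rewrite inE => /eqP ->.
  have Wl : W l <= B by apply: le_B; have /andP[] := frameW 0%N false false.
  have Vl j : V j l <= B by apply: le_B; have /andP[] := frameW j true false.
  apply: (@squeeze_cvgr _ _ _ _ (cst 0) (fun j => sin (t j l) ^+ 2 * (B + B))).
  + apply: nearW => j; rewrite c0/=; have [u _ uE] := cE j l.
    have -> : V j l = cos2_sin2 true (t j l) * (W l + V j l).
      by rewrite (WE j) /V !uE !cos2_sin2_true; ring.
    by rewrite ler_wpM2l ?sqr_ge0// lerD.
  + exact: cvg_cst.
  + rewrite -[0](mul0r (B + B)); apply: cvgMl.
    have t_to0 : t ^~ l @ \oo --> (0 : R).
      rewrite (_ : t ^~ l = geometric (2 * pi * l / b%:R ^+ 2) b%:R^-1).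
        apply: cvg_geometric; rewrite ger0_norm ?invr_ge0 ?ltW//.
        by rewrite invf_lt1// ltr1n.
      apply/funext => j; rewrite /t /= !exprS exprVn expr0 mulr1.
      by field; rewrite expf_neq0 gt_eqF// gt_eqF.
    have sin_to0 : sin (t j l) @[j --> \oo] --> (0 : R).
      rewrite -(@sin0 R); apply: continuous_cvg t_to0; exact: continuous_sin.
    by rewrite -[X in _ --> X](mul0r (0 : R)); exact: cvgM.
- move=> j l r r0; rewrite (WE j) /V /U; have [u u0 uE] := cE j l.
  rewrite !uE !cos2_sin2_true; apply: mixed_weight_le => //.
    by rewrite cos2_sin2_ge0 -subr_ge0 -cos2_sin2_true cos2_sin2_ge0.
  by rewrite cos2_sin2_ge0 cos2_odd_mulr_le.
Qed.
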